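(* Let $K \subset \mathbb{R}^n$ be a convex body and let $T \subset (\mathbb{R}^n)^*\cong\mathbb{R}^n$ be a convex body containing the origin. Then $$\xi_{T}(K-K) \le (n+1)\, \xi_{T}(K).$$ For $n=2$ this estimate is sharp, i.e. the constant $n+1=3$ cannot be replaced by a smaller one that works for all such $K,T$ in dimension $2$.
   Context: A convex body is a compact convex set with nonempty interior; $K-K=\{x-y : x,y\in K\}$ is the Minkowski difference. Let $V=\mathbb{R}^n$ with dual $V^*$ and canonical pairing $\langle\cdot,\cdot\rangle: V^*\times V\to\mathbb{R}$. For a convex body $T\subset V^*$ containing the origin (not necessarily centrally symmetric) put $\|q\|_T=\max_{p\in T}\langle p,q\rangle$ for $q\in V$; this is a possibly non-symmetric norm. For a closed polygonal line $Q=(q_1,\dots,q_m)$ in $V$ put $\ell_T(Q)=\sum_{i=1}^m\|q_{i+1}-q_i\|_T$ with $q_{m+1}=q_1$. Let $\mathcal P_m(K)$ be the set of all $m$-tuples $(q_1,\dots,q_m)$ of points of $V$ such that $\{q_1,\dots,q_m\}\not\subset \operatorname{int}K+t$ for every $t\in V$. Define $$\xi_T(K)=\min_{m\ge2}\ \min_{Q\in\mathcal P_m(K)}\ell_T(Q).$$ (For smooth bodies containing the origin in their interiors, this is the length of the shortest closed billiard trajectory in $K$ with lengths measured by $\|\cdot\|_T$; for general bodies the formula is taken as the definition.) *)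

(* Defs.v *)
From HB Require Import structures.
From mathcomp Require Import all_boot all_order all_algebra.
From mathcomp Require Import all_classical all_reals all_analysis.
Import Order.TTheory GRing.Theory Num.Theory.
Import numFieldNormedType.Exports.

Set Implicit Arguments.
Unset Strict Implicit.
Unset Printing Implicit Defensive.

Local Open Scope classical_set_scope.
Local Open Scope ring_scope.

(* V = R^n is the space 'cV[R]_n of column vectors and its dual V^* is the
   space 'rV[R]_n of row vectors. *)

Definition convex_body (R : realType) (m n : nat) (K : set 'M[R]_(m, n)) : Prop :=
  [/\ compact K, convex_set K & K° !=set0].

Definition pairing (R : realType) (n : nat) (p : 'rV[R]_n) (q : 'cV[R]_n) : R :=
  (p *m q) ord0 ord0.

Definition minkowski_diff (R : realType) (n : nat) (A B : set 'cV[R]_n) :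
    set 'cV[R]_n :=
  [set x - y | x in A & y in B].

Definition translate (R : realType) (n : nat) (A : set 'cV[R]_n) (t : 'cV[R]_n) :
    set 'cV[R]_n :=
  [set x + t | x in A].

(* For T compact and nonempty the supremum is a maximum. *)
Definition support_norm (R : realType) (n : nat) (T : set 'rV[R]_n)
    (q : 'cV[R]_n) : R :=
  sup [set pairing p q | p in T].

(* A closed polygonal line with m vertices is a map Q : 'I_m -> V; the cyclic
   successor ordS plays the role of the convention q_(m+1) = q_1. *)
Definition polygon_length (R : realType) (n m : nat) (T : set 'rV[R]_n)
    (Q : 'I_m -> 'cV[R]_n) : R :=
  \sum_(i < m) support_norm T (Q (ordS i) - Q i).

Definition non_fitting (R : realType) (n m : nat) (K : set 'cV[R]_n) :
    set ('I_m -> 'cV[R]_n) :=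
  [set Q | forall t : 'cV[R]_n, ~ (range Q `<=` translate K° t)].
Arguments non_fitting {R n} m K.

(* The minima over m and Q are rendered by the infimum of a set of reals. When
   T is a convex body containing 0 every length is nonnegative, and when
   moreover 0 < n and K is bounded every non_fitting m K with 2 <= m is
   nonempty, so neither infimum takes the default value of inf. *)
Definition xi (R : realType) (n : nat) (T : set 'rV[R]_n) (K : set 'cV[R]_n) : R :=
  inf [set inf [set polygon_length T Q | Q in non_fitting m K]
      | m in [set m : nat | (2 <= m)%N]].

(* Main.v *)
(* Upper bound: let v_0, ..., v_n span a simplex of maximal volume in K. By
   Cramer's rule the barycentric coordinates lam_i of any x in K satisfy
   lam_i <= 1, so y - x + sum_i v_i = y + sum_i (1 - lam_i) v_i is a combination
   of points of K with nonnegative weights of total n + 1. Hence K - K lies in a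
   translate of (n + 1) K, and if Q does not fit into int K then (n + 1) Q does
   not fit into int (K - K).

   Sharpness: take K = {x, y >= 0, x + y <= 1}, so that K - K is the hexagon
   {|x|, |y|, |x + y| <= 1}, and for T the triangle with vertices
   p_i = a_i - a_(i+1), where the a_i are the outer normals of K. The medial
   triangle of K, traversed in the cheap direction, gives xi_T(K) <= 3/2. If Q
   does not fit into the interior of the hexagon, then by elimination of the
   translation vector Q has width at least 2 in one of the directions a_i, or
   the smallest triangle with normals a_i (or - a_i) around Q has at least the
   size for which three touching vertices of Q force length 9/2. *)

Require Import Defs.
From HB Require Import structures.
From mathcomp Require Import all_boot all_order all_algebra.
From mathcomp Require Import all_classical all_reals all_analysis.
From mathcomp Require Import perm ring lra.
Import Order.TTheory GRing.Theory Num.Theory.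
Import numFieldNormedType.Exports.

Set Implicit Arguments.
Unset Strict Implicit.
Unset Printing Implicit Defensive.

Local Open Scope classical_set_scope.
Local Open Scope ring_scope.

(** * Convex combinations with weights that are not normalised *)

Lemma convex_cone_add (R : realType) (V : lmodType R) (K : set V) (a b : R) (x y : V) :
  convex_set K -> 0 < a -> 0 <= b ->
  K (a^-1 *: x) -> K y -> K ((a + b)^-1 *: (x + b *: y)).
Proof.
move=> cK a0 b0 Kx Ky.
have ab0 : 0 < a + b by exact: ltr_pwDl.
have h1 : 0 <= a / (a + b) by rewrite divr_ge0 // ltW.
have h2 : a / (a + b) <= 1 by rewrite ler_pdivrMr // mul1r lerDl.
have := cK _ _ (Itv01 h1 h2) (mem_set Kx) (mem_set Ky).
move/set_mem; rewrite /conv /=.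
suff -> : a / (a + b) *: (a^-1 *: x) + (1 - a / (a + b)) *: y
          = (a + b)^-1 *: (x + b *: y) by [].
rewrite scalerDr !scalerA; congr (_ *: _ + _ *: _); field; rewrite ?gt_eqF //.
Qed.

(** The point [y] of weight 1 keeps the total weight positive, so dividing by it is legitimate even
    when every [w i] vanishes. The other points join one at a time by [convex_cone_add]. *)
Lemma convex_cone_sum (R : realType) (V : lmodType R) (K : set V)
    (I : finType) (w : I -> R) (v : I -> V) (y : V) :
  convex_set K -> K y -> (forall i, 0 <= w i) -> (forall i, K (v i)) ->
  K ((1 + \sum_i w i)^-1 *: (y + \sum_i w i *: v i)).
Proof.
move=> cK Ky w0 Kv.
suff [] : 0 <= \sum_i w i /\ K ((1 + \sum_i w i)^-1 *: (y + \sum_i w i *: v i)) by [].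
elim: (index_enum I) => [|i s [IH0 IH]].
  by rewrite !big_nil !addr0 invr1 scale1r.
rewrite !big_cons; split; first exact: addr_ge0.
rewrite (addrC (w i)) (addrC (w i *: v i)) !addrA.
by apply: convex_cone_add => //; exact: ltr_pwDl.
Qed.

(** * Simplices of maximal volume and Cramer's rule *)

Section simplex.
Variables (R : realType) (n : nat).
Implicit Types (K : set 'cV[R]_n) (v : 'I_n.+1 -> 'cV[R]_n).

(* Up to the factor n!, its determinant is the volume of the simplex. *)
Definition simplex_mx v : 'M[R]_n.+1 := \matrix_i row_mx (1%:M : 'M[R]_1) (v i)^T.

Lemma simplex_mxE v i j :
  simplex_mx v i j = if fintype.split (j : 'I_(1 + n)) is inr k then v i k 0 else 1.
Proof.
rewrite mxE; rewrite mxE. case: (fintype.splitP _) => k _; rewrite !mxE //.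
by rewrite !ord1 eqxx.
Qed.


(** By the Leibniz formula the determinant is a polynomial in the coordinates of the vertices. The
    product topology is chosen to match Tychonoff's theorem below. *)
Lemma simplex_det_continuous :
  continuous (fun v : prod_topology (fun=> 'cV[R]_n) => \det (simplex_mx v)).
Proof.
rewrite /determinant.
have addC : continuous (fun x : R * R => x.1 + x.2) by exact: add_continuous.
apply: (@continuous_big R _ +%R 0 xpredT addC).
move=> s _ /=.
have mulC : continuous (fun x : R * R => x.1 * x.2) by exact: mul_continuous.
pose g (v : prod_topology (fun=> 'cV[R]_n)) : R := \prod_i simplex_mx v i (s i).
have gC : continuous g.
  apply: (@continuous_big R _ *%R 1 xpredT mulC) => i _ v.
  have -> : (fun x : prod_topology (fun=> 'cV[R]_n) => simplex_mx x i (s i)) =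
    fun x => if fintype.split (s i : 'I_(1 + n)) is inr k then x i k 0 else 1.
    by apply/funext => x; rewrite simplex_mxE.
  case: fintype.split => k; first exact: cst_continuous.
  have pC := @proj_continuous _ (fun=> 'cV[R]_n) i v.
  have kC := @coord_continuous R n 1 k 0 (v i).
  by move=> A /kC; exact: pC.
move=> v; apply: (@cvgM R _ (nbhs v) _ (fun=> (-1) ^+ s) g _ _ _ (gC v)); exact: cvg_cst.
Qed.

(** Cramer's rule: the row (1, x^T) times the inverse matrix lists the barycentric coordinates of
    [x]. Both sides come from expanding along row [i], whose cofactors do not see the replaced
    row. *)
Lemma simplex_det_replace v i x : \det (simplex_mx v) != 0 ->
  \det (simplex_mx (fun j => if j == i then x else v j)) =
  (row_mx 1%:M x^T *m invmx (simplex_mx v)) 0 i * \det (simplex_mx v).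
Proof.
move=> d0; rewrite (expand_det_row _ i) /invmx unitmxE unitfE d0.
rewrite -scalemxAr mxE mulrAC mulVf // mul1r mxE.
apply: eq_bigr => j _; rewrite !mxE eqxx; congr (_ * _).
rewrite /cofactor; congr (_ * \det _).
by apply/matrixP => a b; rewrite !mxE (eq_sym _ i) (negbTE (neq_lift _ _)).
Qed.

Lemma exists_simplex_det_neq0 K : K° !=set0 ->
  exists2 v, forall i, K (v i) & \det (simplex_mx v) != 0.
Proof.
move=> [x0 /nbhs_ballP [e /= e0 sub]].
pose v (i : 'I_n.+1) : 'cV[R]_n :=
  if fintype.split (i : 'I_(1 + n)) is inr k then x0 + (e / 2) *: delta_mx k 0 else x0.
exists v.
  move=> i; apply: sub; rewrite /v; case: fintype.split => k; last first.
    split=> // a b; rewrite /ball /= !mxE opprD addNKr normrN normrM.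
    rewrite gtr0_norm ?divr_gt0 // normr_nat.
    by case: (_ && _); rewrite ?mulr1 ?mulr0 //; lra.
  exact: ballxx.
(* A row [w] killed by the transpose is an affine function vanishing at every vertex. Comparing its
   values at x0 and x0 + (e/2) e_k kills each linear coefficient, and then the constant term. *)
rewrite -det_tr; apply/negP => /det0P [w w0 /matrixP wM].
move/negP: w0; apply; apply/eqP/matrixP => i j; rewrite [i]ord1 mxE {i}.

have wv k : w 0 (@lshift 1 n 0) + \sum_l w 0 (rshift 1 l) * v k l 0 = 0.
  have := wM 0 k; rewrite !mxE (@big_split_ord _ _ _ 1 n) big_ord1 /=.
  rewrite mxE simplex_mxE (unsplitK (inl _)) mulr1 => wk; rewrite -[RHS]wk.
  by congr (_ + _); apply: eq_bigr => l _; rewrite mxE simplex_mxE (unsplitK (inr _)).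
have wx : w 0 (@lshift 1 n 0) + \sum_l w 0 (rshift 1 l) * x0 l 0 = 0.
  by have := wv (@lshift 1 n 0); rewrite /v (unsplitK (inl _)).
have wr k : w 0 (rshift 1 k) = 0.
  have := wv (rshift 1 k); rewrite /v (unsplitK (inr _)).
  under eq_bigr do rewrite !mxE eqxx andbT mulrDr.
  rewrite big_split /= addrA wx add0r (bigD1 k) //= eqxx mulr1 big1; last first.
    by move=> l /negbTE ->; rewrite !mulr0.
  rewrite addr0 => /eqP; rewrite mulf_eq0 => /orP[/eqP //|].
  by rewrite gt_eqF // divr_gt0.
rewrite -(splitK (j : 'I_(1 + n))); case: fintype.split => k /=; last exact: wr.
rewrite ord1; move: wx; rewrite big1 ?addr0 // => l _; rewrite wr mul0r //.
Qed.

(** The tuples of n+1 points of [K] form a compact set by Tychonoff's theorem, so the continuous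
    absolute determinant attains its maximum. That maximum is positive because some simplex is
    nondegenerate. *)
Lemma exists_max_simplex K : compact K -> K° !=set0 ->
  exists v, [/\ forall i, K (v i), \det (simplex_mx v) != 0 &
    forall u, (forall i, K (u i)) ->
      `|\det (simplex_mx u)| <= `|\det (simplex_mx v)|].
Proof.
move=> cK /exists_simplex_det_neq0 [u Ku du].
have cKn := @tychonoff 'I_n.+1 (fun=> 'cV[R]_n) (fun=> K) (fun=> cK).
pose X := prod_topology (fun _ : 'I_n.+1 => 'cV[R]_n).
pose f (v : X) : R := `|\det (simplex_mx v)|.
pose A : set X := [set v | forall i, K (v i)].
have fC : {within A, continuous f}.
  apply: continuous_subspaceT => v; have dC := @simplex_det_continuous v.
  exact: (cvg_norm dC).
have [|v /set_mem /= Kv vmax] := compact_EVT_max _ cKn fC; first by exists u.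
exists v; split => //; last by move=> w Kw; apply: vmax; rewrite inE.
by rewrite -normr_gt0 (lt_le_trans _ (vmax u _)) ?normr_gt0 // inE.
Qed.

Lemma diff_sub_dilate K : convex_body K ->
  exists t, forall z, minkowski_diff K K z -> K (n.+1%:R^-1 *: (z + t)).
Proof.
move=> [compK convK intK].
have [v [Kv dv vmax]] := exists_max_simplex compK intK.
exists (\sum_i v i) => _ [y Ky [x Kx <-]].
pose lam := row_mx (1%:M : 'M[R]_1) x^T *m invmx (simplex_mx v).
have lamM : lam *m simplex_mx v = row_mx 1%:M x^T.
  by rewrite mulmxKV // unitmxE unitfE.
have lamE (k : 'I_(1 + n)) : \sum_i lam 0 i * simplex_mx v i k =
    (row_mx 1%:M x^T : 'rV[R]_(1 + n)) 0 k.
  by have := congr1 (fun M : 'rV[R]_n.+1 => M 0 k) lamM; rewrite mxE.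
have lam1 : \sum_i lam 0 i = 1.
  have := lamE (@lshift 1 n 0); rewrite row_mxEl mxE /= => {}lamE.
  rewrite -[RHS]lamE; apply: eq_bigr => i _.
  by rewrite simplex_mxE (unsplitK (inl _)) mulr1.
have lamx : \sum_i lam 0 i *: v i = x.
  apply/colP => k; have := lamE (rshift 1 k).
  rewrite row_mxEr mxE summxE => {}lamE.
  rewrite -[RHS]lamE; apply: eq_bigr => i _.
  by rewrite simplex_mxE (unsplitK (inr _)) mxE.
(* Replacing vertex [i] by [x] multiplies the determinant by [lam 0 i], which maximality bounds by 1
   in absolute value. *)
have lam_le1 i : lam 0 i <= 1.
  rewrite (le_trans (ler_norm _)) //.
  rewrite -(ler_pM2r (x := `|\det (simplex_mx v)|)) ?normr_gt0 //.
  rewrite mul1r -normrM -simplex_det_replace // vmax // => j.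
  by case: ifP.
have := convex_cone_sum (w := fun i => 1 - lam 0 i) convK Ky _ Kv.
(* The n+1 barycentric coordinates sum to 1, so the total weight is 1 + (n+1) - 1. *)
have -> : 1 + \sum_i (1 - lam 0 i) = n.+1%:R.
  by rewrite sumrB lam1 sumr_const card_ord addrC subrK.
under eq_bigr do rewrite scalerBl scale1r.
rewrite sumrB lamx addrA => Kz; rewrite addrAC; apply: Kz => i.
by rewrite subr_ge0.
Qed.

End simplex.

(** * Support functions as possibly asymmetric norms *)

Section support_norm.
Variables (R : realType) (n : nat).
Implicit Types (T : set 'rV[R]_n) (q : 'cV[R]_n).

Lemma pairingDr p q q' : pairing p (q + q') = pairing p q + pairing p q' :> R.
Proof. by rewrite /pairing mulmxDr mxE. Qed.

Lemma pairingZr (a : R) (p : 'rV[R]_n) q : pairing p (a *: q) = a * pairing p q.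
Proof. by rewrite /pairing -scalemxAr mxE. Qed.

(** A compact [T] is bounded entrywise. This keeps the [sup] in [support_norm] from being a default
    value. *)
Lemma pairing_bounded T q : compact T -> has_ubound [set pairing p q | p in T].
Proof.
move=> /compact_bounded [M [_ MT]].
have M0 : M < M + 1 by lra.
exists (\sum_i (M + 1) * `|q i 0|) => _ [p /(MT _ M0) pM <-].
rewrite (le_trans (ler_norm _)) // /pairing mxE (le_trans (ler_norm_sum _ _ _)) //.
apply: ler_sum => i _; rewrite normrM ler_wpM2r // (le_trans _ pM) //.
rewrite (_ : `|p| = mx_norm p) // mx_normrE.
exact: (le_bigmax _ (fun ij => `|p ij.1 ij.2|) (0, i)).
Qed.

Lemma pairing_le_support_norm T p q : compact T -> T p ->
  pairing p q <= support_norm T q.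
Proof. by move=> cT Tp; apply: ub_le_sup; [exact: pairing_bounded|exists p]. Qed.

Lemma support_norm_le T q c : T !=set0 ->
  (forall p, T p -> pairing p q <= c) -> support_norm T q <= c.
Proof.
move=> [p0 Tp0] Tc; apply: ge_sup; first by exists (pairing p0 q), p0.
by move=> _ [p Tp <-]; exact: Tc.
Qed.

Lemma support_norm_ge0 T q : compact T -> T 0 -> 0 <= support_norm T q.
Proof.
move=> cT /(@pairing_le_support_norm T 0 q cT).
by rewrite {1}/pairing mul0mx mxE.
Qed.

Lemma support_normD T q q' : compact T -> T !=set0 ->
  support_norm T (q + q') <= support_norm T q + support_norm T q'.
Proof.
move=> cT T0; apply: support_norm_le => // p Tp.
by rewrite pairingDr lerD // pairing_le_support_norm.
Qed.

Lemma support_normZ T q (a : R) : compact T -> T !=set0 -> 0 < a ->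
  support_norm T (a *: q) = a * support_norm T q.
Proof.
move=> cT T0 a0; apply/eqP; rewrite eq_le; apply/andP; split.
  apply: support_norm_le => // p Tp.
  by rewrite pairingZr ler_pM2l // pairing_le_support_norm.
rewrite -ler_pdivlMl //; apply: support_norm_le => // p Tp.
by rewrite ler_pdivlMl // -pairingZr pairing_le_support_norm.
Qed.

Lemma polygon_length_ge0 m T (Q : 'I_m -> 'cV[R]_n) : compact T -> T 0 ->
  0 <= polygon_length T Q.
Proof. by move=> cT T0; apply: sumr_ge0 => i _; exact: support_norm_ge0. Qed.

Lemma polygon_lengthZ m T (Q : 'I_m -> 'cV[R]_n) (a : R) :
  compact T -> T !=set0 -> 0 < a ->
  polygon_length T (fun i => a *: Q i) = a * polygon_length T Q.
Proof.
move=> cT T0 a0; rewrite /polygon_length mulr_sumr; apply: eq_bigr => i _.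
by rewrite -scalerBr support_normZ.
Qed.

End support_norm.

(** * Comparing [xi] for [K] and its difference body *)

Section xi.
Variables (R : realType) (n : nat).
Implicit Types (T : set 'rV[R]_n) (K L : set 'cV[R]_n).

(** The inner infimum of [xi], with the number of vertices fixed. *)
Definition xi_m m T K := inf [set polygon_length T Q | Q in non_fitting m K].

Lemma polygon_lengths_lbound m T K : compact T -> T 0 ->
  lbound [set polygon_length T Q | Q in non_fitting m K] 0.
Proof. by move=> cT T0 _ [Q _ <-]; exact: polygon_length_ge0. Qed.

Lemma xi_m_ge0 m T K : compact T -> T 0 -> 0 <= xi_m m T K.
Proof.
move=> cT T0; rewrite /xi_m.
(* With no admissible polygon, [inf] takes its default value 0. *)
have [->|/set0P ne] := eqVneq [set polygon_length T Q | Q in non_fitting m K] set0.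
  by rewrite inf0.
by apply: lb_le_inf => //; exact: polygon_lengths_lbound.
Qed.

Lemma xi_m_le m T K Q : compact T -> T 0 -> non_fitting m K Q ->
  xi_m m T K <= polygon_length T Q.
Proof.
move=> cT T0 QK; apply: ge_inf; last by exists Q.
by exists 0; exact: polygon_lengths_lbound.
Qed.

Lemma xi_le_xi_m m T K : compact T -> T 0 -> (2 <= m)%N -> xi T K <= xi_m m T K.
Proof.
move=> cT T0 m2; apply: ge_inf; last by exists m.
by exists 0 => _ [k _ <-]; exact: xi_m_ge0.
Qed.

Lemma le_xi T K c : (forall m, (2 <= m)%N -> c <= xi_m m T K) -> c <= xi T K.
Proof.
move=> h; apply: lb_le_inf; first by exists (xi_m 2 T K), 2%N.
by move=> _ [m m2 <-]; exact: h.
Qed.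

Lemma le_xi_m m T K c : non_fitting m K !=set0 ->
  (forall Q, non_fitting m K Q -> c <= polygon_length T Q) -> c <= xi_m m T K.
Proof.
move=> [Q0 QK] h; apply: lb_le_inf; first by exists (polygon_length T Q0), Q0.
by move=> _ [Q {}QK <-]; exact: h.
Qed.

(** If the dilated polygon lay in int L + s, the map z -> (z + t)/a, which sends [L] into [K], would
    place [Q] in int K + (s - t)/a. *)
Lemma non_fitting_dilate m K L (a : R) (t : 'cV[R]_n) (Q : 'I_m -> 'cV[R]_n) :
  0 < a -> (forall z, L z -> K (a^-1 *: (z + t))) ->
  non_fitting m K Q -> non_fitting m L (fun i => a *: Q i).
Proof.
move=> a0 LK QK s QL; apply: (QK (a^-1 *: (s - t))) => _ [i _ <-].
have [|y Ly aQ] := QL (a *: Q i); first by exists i.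
exists (a^-1 *: (y + t)); last first.
  by rewrite -scalerDr addrCA addrK addrC aQ scalerA mulVf ?gt_eqF // scale1r.
(* The inverse map w -> a w - t is continuous, so it pulls the neighbourhood [L] of [y] back to a
   neighbourhood contained in [K]: interior points go to interior points. *)
have psiC : {for a^-1 *: (y + t), continuous (fun w : 'cV[R]_n => a *: w - t)}.
  have aC := @scaler_continuous R 'cV[R]_n a (a^-1 *: (y + t)).
  have tC : (fun=> t) @ nbhs (a^-1 *: (y + t)) --> t by exact: cvg_cst.
  exact: (cvgB aC tC).
have psiE : a *: (a^-1 *: (y + t)) - t = y.
  by rewrite scalerA mulfV ?gt_eqF // scale1r addrK.
have : nbhs (a *: (a^-1 *: (y + t)) - t) L by rewrite psiE.
move=> /psiC nL.
apply: (@filterS _ _ _ [set w | L (a *: w - t)] K _ nL) => w /LK.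
by rewrite subrK scalerA mulVf ?gt_eqF // scale1r.
Qed.

(** The difference body contains the translate K - x0. This settles the case where [K] has no
    non-fitting polygon. *)
Lemma non_fitting_diff_body m K : K !=set0 ->
  non_fitting m (minkowski_diff K K) `<=` non_fitting m K.
Proof.
move=> [x0 Kx0] Q QK.
have := non_fitting_dilate (L := K) (t := - x0) ltr01 _ QK.
have -> : (fun i => 1 *: Q i) = Q by apply/funext => i; rewrite scale1r.
by apply=> z Kz; rewrite invr1 scale1r; exists z => //; exists x0.
Qed.

Lemma xi_diff_body_le T K : convex_body K -> convex_body T -> T 0 ->
  xi T (minkowski_diff K K) <= n.+1%:R * xi T K.
Proof.
move=> bK [cT _ _] T0; have n0 : 0 < n.+1%:R :> R by [].
rewrite -ler_pdivrMl //; apply: le_xi => m m2; rewrite ler_pdivrMl //.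
rewrite (le_trans (xi_le_xi_m _ cT T0 m2)) //.
have [x Kx] : K !=set0 by case: bK => _ _ [x /interior_subset Kx]; exists x.
(* If every polygon fits into [K], every one fits into K - K as well, and the left side is the
   default value 0. *)
have [nf0|/set0P ne] := eqVneq (non_fitting m K) set0.
  have -> : xi_m m T (minkowski_diff K K) = 0.
    rewrite /xi_m (_ : non_fitting m _ = set0) ?image_set0 ?inf0 //.
    by rewrite -subset0 -nf0; apply: non_fitting_diff_body; exists x.
  by rewrite mulr_ge0 // xi_m_ge0.
rewrite -ler_pdivrMl //; apply: le_xi_m => // Q QK; rewrite ler_pdivrMl //.
have Tne : T !=set0 by exists 0.
rewrite -polygon_lengthZ //; apply: xi_m_le => //.
by have [t /non_fitting_dilate] := diff_sub_dilate bK; exact.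
Qed.

End xi.

(** * Bounding a closed polygon below by triangles on its vertices *)

Section polygon.
Variables (R : realType) (n : nat) (T : set 'rV[R]_n).
Hypotheses (cT : compact T) (T0 : T 0).
Local Notation N := (support_norm T).

Lemma support_norm_path_le (q : nat -> 'cV[R]_n) (i j : nat) : (i <= j)%N ->
  N (q j - q i) <= \sum_(i <= k < j) N (q k.+1 - q k).
Proof.
have Tne : T !=set0 by exists 0.
elim: j => [|j IH]; rewrite leq_eqVlt => /predU1P[->|//].
- by rewrite big_geq // subrr support_norm_le // => p _; rewrite /pairing mulmx0 mxE.
- by rewrite big_geq // subrr support_norm_le // => p _; rewrite /pairing mulmx0 mxE.
rewrite ltnS => ij; rewrite big_nat_recr //=.
rewrite -[q j.+1](subrK (q j)) -addrA addrC (le_trans (support_normD _ _ cT Tne)) //.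
by rewrite addrK lerD2r IH.
Qed.

(** Cut the polygon at [i], [j], [k] and apply the triangle inequality to each arc. The closing arc
    runs from [k] through the index m+1, identified with 0, on to [i]. *)
Lemma polygon_length_ge_ordered_triangle m (Q : 'I_m.+1 -> 'cV[R]_n) (i j k : 'I_m.+1) :
  (i <= j)%N -> (j <= k)%N ->
  N (Q j - Q i) + N (Q k - Q j) + N (Q i - Q k) <= polygon_length T Q.
Proof.
move=> ij jk; have Tne : T !=set0 by exists 0.
(* The periodic extension to [nat] turns arcs into integer intervals. *)
pose q (l : nat) := Q (inord (l %% m.+1)).
have qE (l : 'I_m.+1) : Q l = q l.
  by rewrite /q modn_small // inord_val.
have q_wrap : q m.+1 = q 0 by rewrite /q modnn mod0n.
have -> : polygon_length T Q = \sum_(0 <= l < m.+1) N (q l.+1 - q l).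
  rewrite big_mkord; apply: eq_bigr => l _; rewrite (qE l).
  by congr (N (Q _ - _)); apply: val_inj; rewrite /= inordK // ltn_mod.
have km : (k <= m.+1)%N by exact: ltnW.
rewrite (@big_cat_nat _ _ _ i) //=; last exact: leq_trans ij (leq_trans jk km).
rewrite (@big_cat_nat _ _ _ j i) //=; last exact: leq_trans jk km.
rewrite (@big_cat_nat _ _ _ k j) //= !qE.
have h1 := support_norm_path_le q (leq0n i).
have h2 := support_norm_path_le q ij.
have h3 := support_norm_path_le q jk.
have h4 := support_norm_path_le q km.
have := support_normD (q i - q 0) (q m.+1 - q k) cT Tne.
rewrite q_wrap (addrA (q i - q 0)) subrK => h5; rewrite q_wrap in h4.
lra.
Qed.

(* A closed polygonal line visits three of its vertices in one of the two cyclic orders. *)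
Lemma polygon_length_ge_triangle m (Q : 'I_m.+1 -> 'cV[R]_n) (i j k : 'I_m.+1) :
  N (Q j - Q i) + N (Q k - Q j) + N (Q i - Q k) <= polygon_length T Q \/
  N (Q k - Q i) + N (Q j - Q k) + N (Q i - Q j) <= polygon_length T Q.
Proof.
have P := polygon_length_ge_ordered_triangle Q.
have [ij|/ltnW ji] := leqP i j; have [jk|/ltnW kj] := leqP j k;
  have [ik|/ltnW ki] := leqP i k.
- by left; exact: P.
- by left; have := P _ _ _ ij jk; lra.
- by right; have := P _ _ _ ik kj; lra.
- by left; have := P _ _ _ ki ij; lra.
- by right; have := P _ _ _ ji ik; lra.
- by left; have := P _ _ _ jk ki; lra.
- by right; have := P _ _ _ kj ji; lra.
- by right; have := P _ _ _ kj ji; lra.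
Qed.

(** The degenerate triangle [i], [j], [i], whose third side has nonnegative length. *)
Lemma polygon_length_ge_segment m (Q : 'I_m.+1 -> 'cV[R]_n) (i j : 'I_m.+1) :
  N (Q j - Q i) + N (Q i - Q j) <= polygon_length T Q.
Proof.
have := support_norm_ge0 (Q i - Q i) cT T0.
by have [] := polygon_length_ge_triangle Q i j i; lra.
Qed.

End polygon.

(** * Closed, open and compact sets given by inequalities, and two order facts *)

Lemma le_closed (R : realType) (X : topologicalType) (f : X -> R) (c : R) :
  continuous f -> closed [set x | f x <= c].
Proof.
move=> fC; apply: (preimage_closed (D := [set y | y <= c])); last exact: closed_le.
by move=> x _; exact: fC.
Qed.

Lemma norm_lt1_open (R : realType) (X : topologicalType) (f : X -> R) :
  continuous f -> open [set x | `|f x| < 1].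
Proof.
move=> fC; apply: (@open_comp _ _ (fun x => `|f x|) [set y : R | y < 1]); last exact: open_lt.
by move=> x _; exact: (cvg_norm (fC x)).
Qed.

Lemma trmx_continuous (R : realType) m n :
  continuous (@trmx R m n).
Proof.
move=> x A /nbhs_ballP [e e0 sub]; apply/nbhs_ballP; exists e => // y [_ xy].
by apply: sub; split=> // i j; rewrite !mxE; exact: xy.
Qed.

Lemma closed_bounded_row_compact (R : realType) n (A : set 'rV[R]_n) (c : R) :
  closed A -> (forall x, A x -> forall i, `|x 0 i| <= c) -> compact A.
Proof.
move=> Acl Ac.
have boxC := @rV_compact R n (fun=> `[- c, c]%classic) (fun=> @segment_compact _ _ _).
apply: subclosed_compact Acl boxC _ => x Ax i.
by rewrite /= in_itv /= -ler_norml; exact: Ac.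
Qed.

(** Transposition is continuous and carries the statement over from rows. *)
Lemma closed_bounded_col_compact (R : realType) n (A : set 'cV[R]_n) (c : R) :
  closed A -> (forall x, A x -> forall i, `|x i 0| <= c) -> compact A.
Proof.
move=> Acl Ac.
have -> : A = trmx @` [set y : 'rV[R]_n | A y^T].
  by apply/seteqP; split=> [x Ax|_ [y Ay <-] //]; exists x^T; rewrite /= trmxK.
apply: continuous_compact.
  by apply: continuous_subspaceT; exact: trmx_continuous.
apply: (@closed_bounded_row_compact _ _ _ c).
  by apply: preimage_closed => // y _; exact: trmx_continuous.
by move=> y /Ac yc i; have := yc i; rewrite mxE.
Qed.

(** Take the midpoint of the larger lower bound and the smaller upper bound. This is the elimination
    step that later picks the coordinates of a translation vector. *)
Lemma exists_between (R : realFieldType) (a b c d : R) :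
  a < c -> a < d -> b < c -> b < d ->
  exists t, [/\ a < t, b < t, t < c & t < d].
Proof.
move=> ac ad bc bd.
have [ab|ba] := lerP a b; have [cd|dc] := lerP c d.
- by exists ((b + c) / 2); split; lra.
- by exists ((b + d) / 2); split; lra.
- by exists ((a + c) / 2); split; lra.
- by exists ((a + d) / 2); split; lra.
Qed.

Lemma exists_argmax (R : realType) m (f : 'I_m.+1 -> R) :
  exists i, forall j, f j <= f i.
Proof.
have [i _ fi] := @Order.TotalTheory.arg_maxP _ _ _ ord0 xpredT f isT.
by exists i => j; exact: fi.
Qed.

(** * The planar example: triangle, dual triangle and hexagon *)

Section plane.
Variable R : realType.

Definition pt (a b : R) : 'cV[R]_2 := \col_i (if i == 0 then a else b).

Lemma pt0 a b : pt a b 0 0 = a. Proof. by rewrite mxE. Qed.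

Lemma pt1 a b : pt a b 1 0 = b. Proof. by rewrite mxE. Qed.

Lemma col2P (x y : 'cV[R]_2) : x 0 0 = y 0 0 -> x 1 0 = y 1 0 -> x = y.
Proof.
move=> e0 e1; apply/colP => -[[|[|//]] h].
  by rewrite (_ : Ordinal h = 0) //; exact: val_inj.
by rewrite (_ : Ordinal h = 1) //; exact: val_inj.
Qed.

Lemma pairing2 (p : 'rV[R]_2) q : pairing p q = p 0 0 * q 0 0 + p 0 1 * q 1 0.
Proof.
rewrite /pairing mxE big_ord_recl big_ord1.
by rewrite (_ : lift ord0 ord0 = 1) //; exact: val_inj.
Qed.

Definition std_triangle : set 'cV[R]_2 :=
  [set x | [/\ 0 <= x 0 0, 0 <= x 1 0 & x 0 0 + x 1 0 <= 1]].

(* Its vertices p_0 = (-1, 1), p_1 = (-1, -2), p_2 = (2, 1) are the differences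
   a_i - a_(i+1) of the outer normals (-1, 0), (0, -1), (1, 1) of std_triangle. *)
Definition dual_triangle : set 'rV[R]_2 :=
  [set p | [/\ -1 <= p 0 0, p 0 1 <= 1 & p 0 0 - p 0 1 <= 1]].

Lemma dual_triangle0 : dual_triangle 0.
Proof. by rewrite /dual_triangle /= !mxE; split; lra. Qed.

Lemma std_triangle_convex_body : convex_body std_triangle.
Proof.
split.
- apply: (@closed_bounded_col_compact _ _ _ 1).
    rewrite (_ : std_triangle = [set x : 'cV[R]_2 | - x 0 0 <= 0] `&`
      [set x : 'cV[R]_2 | - x 1 0 <= 0] `&` [set x : 'cV[R]_2 | x 0 0 + x 1 0 <= 1]); last first.
      by apply/seteqP; split=> x /=; rewrite /std_triangle /= !oppr_le0 => -[]; [|case].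
    have cC i := @coord_continuous R 2 1 i 0.
    apply: closedI; first apply: closedI; apply: le_closed => x.
    + exact: (cvgN (cC 0 x)).
    + exact: (cvgN (cC 1 x)).
    + exact: (cvgD (cC 0 x) (cC 1 x)).
  move=> x [x0 x1 x01] [[|[|//]] h].
    rewrite (_ : Ordinal h = 0); last exact: val_inj.
    by rewrite ger0_norm //; lra.
  rewrite (_ : Ordinal h = 1); last exact: val_inj.
  by rewrite ger0_norm //; lra.
- move=> x y l /set_mem [x0 x1 x01] /set_mem [y0 y1 y01]; apply/mem_set.
  have l0 : 0 <= l%:num by [].
  have l1 : 0 <= 1 - l%:num by rewrite subr_ge0.
  rewrite /conv /= /std_triangle /= !mxE /unstable.onem.
  have h1 := mulr_ge0 l0 x0; have h2 := mulr_ge0 l0 x1.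
  have h3 := mulr_ge0 l1 y0; have h4 := mulr_ge0 l1 y1.
  have h5 := ler_wpM2l l0 x01; have h6 := ler_wpM2l l1 y01.
   by split; lra.
- exists (pt 3^-1 3^-1); apply/nbhs_ballP; exists 6^-1 => /=; first lra.
  move=> y [_ yb]; have := yb 0 0; have := yb 1 0.
  rewrite /ball /= pt0 pt1 !ltr_norml => /andP[? ?] /andP[? ?].
  by split; lra.
Qed.

Lemma dual_triangle_convex_body : convex_body dual_triangle.
Proof.
split.
- apply: (@closed_bounded_row_compact _ _ _ 2).
    rewrite (_ : dual_triangle = [set p : 'rV[R]_2 | - p 0 0 <= 1] `&`
      [set p : 'rV[R]_2 | p 0 1 <= 1] `&` [set p : 'rV[R]_2 | p 0 0 - p 0 1 <= 1]); last first.
      by apply/seteqP; split=> x /=; rewrite /dual_triangle /= lerNl => -[]; [|case].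
    have cC i := @coord_continuous R 1 2 0 i.
    apply: closedI; first apply: closedI; apply: le_closed => x.
    + exact: (cvgN (cC 0 x)).
    + exact: (cC 1 x).
    + exact: (cvgB (cC 0 x) (cC 1 x)).
  move=> x [x0 x1 x01] [[|[|//]] h].
    rewrite (_ : Ordinal h = 0); last exact: val_inj.
    by rewrite ler_norml; apply/andP; split; lra.
  rewrite (_ : Ordinal h = 1); last exact: val_inj.
  by rewrite ler_norml; apply/andP; split; lra.
- move=> x y l /set_mem [x0 x1 x01] /set_mem [y0 y1 y01]; apply/mem_set.
  have l0 : 0 <= l%:num by [].
  have l1 : 0 <= 1 - l%:num by rewrite subr_ge0.
  rewrite /conv /= /dual_triangle /= !mxE /unstable.onem.
  have h1 := ler_wpM2l l0 x0; have h2 := ler_wpM2l l0 x1.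
  have h3 := ler_wpM2l l1 y0; have h4 := ler_wpM2l l1 y1.
  have h5 := ler_wpM2l l0 x01; have h6 := ler_wpM2l l1 y01.
  by split; lra.
- exists 0; apply/nbhs_ballP; exists 3^-1 => /=; first lra.
  move=> y [_ yb]; have := yb 0 0; have := yb 0 1.
  rewrite /ball /= !mxE !ltr_norml => /andP[? ?] /andP[? ?].
  by split; lra.
Qed.

Lemma interior_std_triangle x : std_triangle° x ->
  [/\ 0 < x 0 0, 0 < x 1 0 & x 0 0 + x 1 0 < 1].
Proof.
move=> /nbhs_ballP [e /= e0 sub].
(* Diagonal shifts suffice: the negative one makes both coordinates positive, the positive one makes
   their sum less than 1. *)
have near s : `|s| < e -> std_triangle (pt (x 0 0 + s) (x 1 0 + s)).
  move=> se; apply: sub; split=> // i j; rewrite /ball /= [j]ord1 mxE.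
  case: eqP => [->|/eqP i0]; first by rewrite opprD addNKr normrN.
  have -> : i = 1 by case: i i0 => [[|[|//]] h] // _; exact: val_inj.
  by rewrite opprD addNKr normrN.
have se : `|e / 2| < e by rewrite gtr0_norm; lra.
have := near _ se; rewrite -normrN in se; have := near _ se.
by rewrite /std_triangle /= !pt0 !pt1 => -[? ? _] [_ _ ?]; split; lra.
Qed.

Lemma hexagon_sub_diff (x : 'cV[R]_2) :
  `|x 0 0| < 1 -> `|x 1 0| < 1 -> `|x 0 0 + x 1 0| < 1 ->
  (minkowski_diff std_triangle std_triangle)° x.
Proof.
have cC i := @coord_continuous R 2 1 i 0.
pose H := [set x : 'cV[R]_2 | `|x 0 0| < 1] `&` [set x : 'cV[R]_2 | `|x 1 0| < 1]
  `&` [set x : 'cV[R]_2 | `|x 0 0 + x 1 0| < 1].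
have oH : open H.
  apply: openI; first apply: openI; apply: norm_lt1_open => y.
  - exact: (cC 0 y).
  - exact: (cC 1 y).
  - exact: (cvgD (cC 0 y) (cC 1 y)).
suff HD : H `<=` minkowski_diff std_triangle std_triangle.
  move=> x0 x1 x01; apply: (interiorS HD).
  by move: oH; rewrite openE; apply; split=> //; split.
move=> y [[/=]]; rewrite !ltr_norml => /andP[? ?] /andP[? ?] /andP[? ?].
(* In each sign case the two witnesses are the coordinatewise positive and negative parts of [y]. *)
have [h0|h0] := lerP 0 (y 0 0); have [h1|h1] := lerP 0 (y 1 0);
  [exists (pt (y 0 0) (y 1 0)); last exists (pt 0 0)
  |exists (pt (y 0 0) 0); last exists (pt 0 (- y 1 0))
  |exists (pt 0 (y 1 0)); last exists (pt (- y 0 0) 0)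
  |exists (pt 0 0); last exists (pt (- y 0 0) (- y 1 0))];
  try (by rewrite /std_triangle /= ?pt0 ?pt1; split; lra);
  apply: col2P; rewrite mxE mxE ?pt0 ?pt1 ?[X in _ + X]mxE ?pt0 ?pt1; lra.
Qed.

Lemma diff_std_triangle_bound x :
  minkowski_diff std_triangle std_triangle x -> -1 <= x 0 0 <= 1.
Proof.
by move=> [a [? ? ?] [b [? ? ?] <-]]; rewrite !mxE; apply/andP; split; lra.
Qed.

Lemma xi_std_triangle_le : xi dual_triangle std_triangle <= 3 / 2.
Proof.
have [cT _ _] := dual_triangle_convex_body.
rewrite (le_trans (xi_le_xi_m (m := 3) _ cT dual_triangle0 _)) //.
(* The midpoints (1/2, 0), (1/2, 1/2), (0, 1/2) of the sides. Fitting into the interior shifted by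
   [t] would force t_0 < 0, t_1 < 0 and t_0 + t_1 > 0. *)
pose Q (i : 'I_3) :=
  pt (if val i == 2%N then 0 else 2^-1) (if val i == 0%N then 0 else 2^-1).
rewrite (le_trans (xi_m_le cT dual_triangle0 (Q := Q) _)) //.
  move=> t Qt.
  have Qi i : [/\ 0 < Q i 0 0 - t 0 0, 0 < Q i 1 0 - t 1 0 &
      (Q i 0 0 - t 0 0) + (Q i 1 0 - t 1 0) < 1].
    have [|y /interior_std_triangle [y0 y1 y01] <-] := Qt (Q i); first by exists i.
    by rewrite !mxE !addrK.
  have [] := Qi 0; have [] := Qi 1; have [] := Qi 2%:R.
  rewrite /Q !pt0 !pt1 /=; lra.
(* The three sides, paired with [p], give the halved left sides of the inequalities defining
   [dual_triangle]. *)
have side i : support_norm dual_triangle (Q (ordS i) - Q i) <= 2^-1.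
  apply: support_norm_le; first by exists 0; exact: dual_triangle0.
  move=> p [? ? ?]; rewrite pairing2 !mxE.
  by case: i => [[|[|[|//]]] h] /=; lra.
rewrite /polygon_length (le_trans (ler_sum _ (fun i _ => side i))) //.
by rewrite sumr_const card_ord; lra.
Qed.

Lemma support_norm_dual_ge (a b : R) (q : 'cV[R]_2) :
  -1 <= a -> b <= 1 -> a - b <= 1 ->
  a * q 0 0 + b * q 1 0 <= support_norm dual_triangle q.
Proof.
move=> a1 b1 ab; have [cT _ _] := dual_triangle_convex_body.
pose p : 'rV[R]_2 := \row_j (if j == 0 then a else b).
have -> : a * q 0 0 + b * q 1 0 = pairing p q by rewrite pairing2 !mxE.
by apply: pairing_le_support_norm => //; rewrite /dual_triangle /= !mxE; split.
Qed.

(** * Lower bounds for polygons that do not fit into the hexagon *)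

Section lower_bound.
Variables (m : nat) (Q : 'I_m.+1 -> 'cV[R]_2).
Let l := polygon_length dual_triangle Q.
Let cT : compact dual_triangle. Proof. by case: dual_triangle_convex_body. Qed.
Let N_ge a b (i j : 'I_m.+1) : -1 <= a -> b <= 1 -> a - b <= 1 ->
  a * (Q j 0 0 - Q i 0 0) + b * (Q j 1 0 - Q i 1 0) <=
  support_norm dual_triangle (Q j - Q i).
Proof.
move=> a1 b1 ab; have := support_norm_dual_ge (Q j - Q i) a1 b1 ab.
by rewrite !mxE.
Qed.

(** Pair the two directions of a segment with two vertices of [dual_triangle]: p_2 - p_0 = (3, 0),
    p_0 - p_1 = (0, 3) and p_2 - p_1 = (3, 3). *)
Lemma length_ge_width i j :
  [/\ 3 * (Q i 0 0 - Q j 0 0) <= l, 3 * (Q i 1 0 - Q j 1 0) <= l &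
      3 * ((Q i 0 0 + Q i 1 0) - (Q j 0 0 + Q j 1 0)) <= l].
Proof.
have := polygon_length_ge_segment cT dual_triangle0 Q j i; rewrite -/l => seg.
have p0 := @N_ge (-1) 1; have p1 := @N_ge (-1) (-2); have p2 := @N_ge 2 1.
by split; [have := p2 j i | have := p0 j i | have := p2 j i];
  [have := p0 i j | have := p1 i j | have := p1 i j]; lra.
Qed.

(* Since p_(i-1) - p_i = -3 a_i, pairing the sides of the triangle with the
   points p_i / 2 of dual_triangle gives the bound for one orientation; the
   points - p_i / 2, which also lie in dual_triangle, serve the other one. *)
Lemma length_ge_triple i j k :
  3 / 2 * (Q i 0 0 + Q j 1 0 - (Q k 0 0 + Q k 1 0)) <= l /\
  3 / 2 * (Q k 0 0 + Q k 1 0 - Q i 0 0 - Q j 1 0) <= l.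
Proof.
have p0 := @N_ge (- 2^-1) 2^-1; have n0 := @N_ge 2^-1 (- 2^-1).
have p1 := @N_ge (- 2^-1) (-1); have n1 := @N_ge 2^-1 1.
have p2 := @N_ge 1 2^-1; have n2 := @N_ge (-1) (- 2^-1).
have [] := polygon_length_ge_triangle cT dual_triangle0 Q i j k; rewrite -/l => tri.
  split; [have := p0 i j | have := n0 i j]; [have := p1 j k | have := n1 j k];
    [have := p2 k i | have := n2 k i]; lra.
split; [have := n0 j i | have := p0 j i]; [have := n1 k j | have := p1 k j];
  [have := n2 i k | have := p2 i k]; lra.
Qed.

Lemma length_ge_non_fitting :
  non_fitting m.+1 (minkowski_diff std_triangle std_triangle) Q -> 9 / 2 <= l.
Proof.
move=> QD; rewrite leNgt; apply/negP => l_lt.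
have [i1 A] := exists_argmax (fun i => Q i 0 0).
have [i2 A'] := exists_argmax (fun i => - Q i 0 0).
have [i3 B] := exists_argmax (fun i => Q i 1 0).
have [i4 B'] := exists_argmax (fun i => - Q i 1 0).
have [i5 C] := exists_argmax (fun i => Q i 0 0 + Q i 1 0).
have [i6 C'] := exists_argmax (fun i => - (Q i 0 0 + Q i 1 0)).
have [wA _ _] := length_ge_width i1 i2.
have [_ wB _] := length_ge_width i3 i4.
have [_ _ wC] := length_ge_width i5 i6.
have [tr1 _] := length_ge_triple i1 i3 i6.
have [_ tr2] := length_ge_triple i2 i4 i5.
(* Fourier-Motzkin elimination of t_1 leaves these bounds on t_0. They are compatible because length
   below 9/2 makes all three widths less than 3/2 and both triple expressions less than 3. *)
have [||||t0 [t01 t02 t03 t04]] := @exists_between _ (Q i1 0 0 - 1)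
  (Q i5 0 0 + Q i5 1 0 - Q i4 1 0 - 2) (Q i2 0 0 + 1)
  (Q i6 0 0 + Q i6 1 0 - Q i3 1 0 + 2); try lra.
(* The bounds on t_1 come from the second coordinate and from the coordinate sum; the choice of t_0
   makes them compatible. *)
have [||||t1 [t11 t12 t13 t14]] := @exists_between _ (Q i3 1 0 - 1)
  (Q i5 0 0 + Q i5 1 0 - 1 - t0) (Q i4 1 0 + 1)
  (Q i6 0 0 + Q i6 1 0 + 1 - t0); try lra.
apply: (QD (pt t0 t1)) => _ [i _ <-].
exists (Q i - pt t0 t1); last by rewrite subrK.
have := A i; have := A' i; have := B i; have := B' i; have := C i; have := C' i.
move=> ? ? ? ? ? ?.
have e0 : (Q i - pt t0 t1) 0 0 = Q i 0 0 - t0 by rewrite mxE mxE pt0.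
have e1 : (Q i - pt t0 t1) 1 0 = Q i 1 0 - t1 by rewrite mxE mxE pt1.
apply: hexagon_sub_diff; rewrite ?e0 ?e1 ltr_norml; apply/andP; split; lra.
Qed.

End lower_bound.

Lemma xi_diff_std_triangle_ge :
  9 / 2 <= xi dual_triangle (minkowski_diff std_triangle std_triangle).
Proof.
apply: le_xi => -[|[|m]] // _; apply: le_xi_m => [|Q]; last exact: length_ge_non_fitting.
(* A witness that the infimum is not a default value: 0 and (5, 0) are too far apart for a body of
   horizontal width 2. *)
exists (fun i : 'I_m.+2 => if i == 0 then 0 else pt 5 0) => t Qt.
have [|y /interior_subset/diff_std_triangle_bound yb y0] := Qt 0; first by exists 0.
have [|z /interior_subset/diff_std_triangle_bound zb z5] := Qt (pt 5 0).
  by exists ord_max.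
have := congr1 (fun M : 'cV[R]_2 => M 0 0) y0.
have := congr1 (fun M : 'cV[R]_2 => M 0 0) z5.
by rewrite /= !mxE /=; move: yb zb => /andP[? ?] /andP[? ?]; lra.
Qed.

End plane.

Theorem theorem2p1 (R : realType) :
  (forall (n : nat) (K : set 'cV[R]_n) (T : set 'rV[R]_n),
     convex_body K -> convex_body T -> T 0 ->
     xi T (minkowski_diff K K) <= n.+1%:R * xi T K)
  /\
  (forall c : R, c < 3 ->
     ~ (forall (K : set 'cV[R]_2) (T : set 'rV[R]_2),
          convex_body K -> convex_body T -> T 0 ->
          xi T (minkowski_diff K K) <= c * xi T K)).
Proof.
split=> [n K T|c c3 H]; first exact: xi_diff_body_le.
have [cT _ _] := dual_triangle_convex_body R.
have := H _ _ (std_triangle_convex_body R) (dual_triangle_convex_body R)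
  (dual_triangle0 R).
have lo := xi_diff_std_triangle_ge R.
have up := xi_std_triangle_le R.
have pos : 0 <= xi (@dual_triangle R) (@std_triangle R).
  by apply: le_xi => m _; exact: xi_m_ge0 cT (dual_triangle0 R).
move=> le_c; have : 9 / 2 <= c * xi (@dual_triangle R) (@std_triangle R) by lra.
have := ler_wpM2r pos (ltW c3).
(* The upper bound 3/2 on [xi] may be multiplied by [c] only for positive [c], giving less than 9/2;
   otherwise the product is at most 0. *)
case: (lerP c 0) => c0; first by have := mulr_le0_ge0 c0 pos; lra.
by have := ler_wpM2l (ltW c0) up; lra.
Qed.
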